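(* Let $H\in\mathcal N_2$ be a normal affine semigroup in $\mathbb N^2$ with extremal rays $\mathbf a_1=(x_1,y_1)$ and $\mathbf a_2=(x_2,y_2)$, labeled so that $\mathbf a_1$ is closer to the $x$-axis, and let $\mathbf b=(u,v)$ be the bottom element of $H$. Assume that $H_1^*\neq\emptyset$. For any integer $i$ let $q_i,r_i$ be the integers with $iy_1=q_ix_1+r_i$ and $0\le r_i<x_1$. Let $k$ be an integer with $u<k<x_1$. The following statements are equivalent: (i) $k$ is the $x$-coordinate of some $\mathbf p\in H_1^*$; (ii) $\lceil ky_1/x_1\rceil\le v+\lfloor (k-u)y_1/x_1\rfloor$; (iii) $\lceil ky_1/x_1\rceil= v+\lfloor (k-u)y_1/x_1\rfloor$; (iv) $q_k\le v-1+q_{k-u}$; (v) $q_k= v-1+q_{k-u}$; (vi) $r_k\ge r_{k-u}+x_1-(vx_1-uy_1)$; (vii) $r_k= r_{k-u}+x_1-(vx_1-uy_1)$; (viii) $r_k\ge x_1-(vx_1-uy_1)$. If any of these conditions holds, then $\mathbf p=(k,\lceil ky_1/x_1\rceil)=(k,q_k+1)$ (where $\mathbf p$ is the point in (i)).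
   Context: $\mathbb N=\{0,1,2,\dots\}$. $\mathcal N_2$ is the class of normal affine semigroups $H\subseteq\mathbb N^2$ generating $\mathbb Z^2$ as a group: $H$ is a finitely generated submonoid of $\mathbb N^2$ with $H=C\cap\mathbb Z^2$, where $C\subseteq\mathbb R^2$ is the (two-dimensional) cone generated by $H$. The extremal rays of $H$ are the primitive lattice vectors $\mathbf a_1,\mathbf a_2\in H$ lying on the two extremal rays of $C$. They are labeled $\mathbf a_1=(x_1,y_1)$, $\mathbf a_2=(x_2,y_2)$ so that $x_1>0$ and either $x_2=0$ or $y_1/x_1<y_2/x_2$. Put $\omega_H=\mathbb Z^2\cap\operatorname{relint}C$. The bottom element $\mathbf b$ of $H$ is the unique element of $\omega_H$ that is minimal (least) in $\omega_H$ for the componentwise order on $\mathbb N^2$ (it always exists). $H_1^*=\mathbb Z^2\cap\{r\mathbf a_1+s\mathbf b:0<r,s<1\}$. *)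

(* Defs.v *)
From HB Require Import structures.
From mathcomp Require Import all_boot all_order all_algebra.
From mathcomp Require Import all_classical all_reals all_analysis.

Set Implicit Arguments.
Unset Strict Implicit.
Unset Printing Implicit Defensive.

Import Order.TTheory GRing.Theory Num.Theory.
Import numFieldNormedType.Exports.

Local Open Scope classical_set_scope.
Local Open Scope ring_scope.

Definition submonoid (M : set (int * int)) : Prop :=
  M 0 /\ forall p q, M p -> M q -> M (p + q).

Definition subgroup (G : set (int * int)) : Prop :=
  G 0 /\ forall p q, G p -> G q -> G (p - q).

Definition primitive (p : int * int) : bool := coprimez p.1 p.2.

Section Cones.
Variable R : realType.
Implicit Types (A C L : set (R * R)) (H : set (int * int)).

Definition toR2 (p : int * int) : R * R := (p.1%:~R, p.2%:~R).

Definition convex_cone C : Prop :=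
  [/\ C 0, forall x y, C x -> C y -> C (x + y)
    & forall (t : R) x, 0 <= t -> C x -> C (t *: x)].

Definition cone H : set (R * R) := smallest convex_cone (toR2 @` H).

Definition affine_subspace A : Prop :=
  forall (t : R) x y, A x -> A y -> A (t *: x + (1 - t) *: y).

Definition affine_hull A : set (R * R) := smallest affine_subspace A.

Definition relint A : set (R * R) :=
  [set x | A x /\ \forall y \near x, affine_hull A y -> A y].

Definition ray (x : R * R) : set (R * R) :=
  [set y | exists2 t : R, 0 <= t & y = t *: x].

(* Rays that are faces of C, i.e. its one-dimensional faces when C is pointed. *)
Definition extremal_ray C L : Prop :=
  [/\ exists2 x, x != 0 & L = ray x, L `<=` C
    & forall x y, C x -> C y -> L (x + y) -> L x /\ L y].

(* The class N_2.  Since H is contained in N^2, its elements are represented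
   as pairs of nonnegative integers. *)
Definition normal_affine_semigroup2 H : Prop :=
  [/\ forall p, H p -> 0 <= p.1 /\ 0 <= p.2,
      exists s : seq (int * int), H = smallest submonoid [set` s],
      smallest subgroup H = setT
    & H = toR2 @^-1` cone H].

Definition extremal_vector H (a : int * int) : Prop :=
  [/\ H a, primitive a & exists2 L, extremal_ray (cone H) L & L (toR2 a)].

Definition omega H : set (int * int) := toR2 @^-1` relint (cone H).

Definition bottom_element H (b : int * int) : Prop :=
  omega H b /\ forall p, omega H p -> b.1 <= p.1 /\ b.2 <= p.2.

Definition Hstar (a b : int * int) : set (int * int) :=
  [set p | exists r s : R, [/\ 0 < r < 1, 0 < s < 1
                             & toR2 p = r *: toR2 a + s *: toR2 b]].

End Cones.

(* Main.v *)
(* The cone C lies above the line of a1, since otherwise the extremal ray of a1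
   would be interior to the cone spanned by a2 and a point below that line.
   With D = det (a1, b) this gives D > 0, and minimality of b gives D <= x1:
   otherwise (u, v - 1) would still be interior to C.  A lattice point p with
   u < p.1 < x1 lies in H_1^* iff 0 < det (a1, p) < D, and every listed
   condition compares r_k - r_(k-u) + D - x1, which is x1 times the integer
   v - 1 + q_(k-u) - q_k <= 0, with 0. *)
Require Import Defs.
From HB Require Import structures.
From mathcomp Require Import all_boot all_order all_algebra.
From mathcomp Require Import all_classical all_reals all_analysis.
From mathcomp Require Import ring lra zify.

Set Implicit Arguments.
Unset Strict Implicit.
Unset Printing Implicit Defensive.

Import Order.TTheory GRing.Theory Num.Theory.
Import numFieldNormedType.Exports.

Local Open Scope classical_set_scope.
Local Open Scope ring_scope.

(** Kept over any ring so that it serves lattice points and real points alike. For [a.1 > 0] it is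
    positive exactly when [p] lies above the line through the origin and [a]. *)
Definition det2 (T : pzRingType) (a p : T * T) : T := a.1 * p.2 - a.2 * p.1.

Lemma det2_toR2 (R : realType) (a p : int * int) :
  det2 (toR2 R a) (toR2 R p) = (det2 a p)%:~R.
Proof. by rewrite /det2 /= intrB !intrM. Qed.

Lemma scale_pairE (R : pzRingType) (t : R) (x : R^o * R^o) :
  t *: x = (t * x.1, t * x.2).
Proof. by []. Qed.

Section ConeGeometry.
Variable R : realType.
Implicit Types (C L : set (R * R)) (a b x : R * R) (H : set (int * int)).

Lemma cone_convex H : convex_cone (cone H : set (R * R)).
Proof.
split=> [C [[]]//|x y Cx Cy C CP|t x t0 Cx C CP].
- by case: (CP) => -[_ + _] _; apply; [exact: Cx|exact: Cy].
- by case: (CP) => -[_ _ +] _; apply; [|exact: Cx].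
Qed.

Lemma toR2_cone H p : H p -> cone H (toR2 R p).
Proof. by move=> Hp C [_]; apply; exists p. Qed.

Lemma cone_ge0 H x : (forall p, H p -> 0 <= p.1 /\ 0 <= p.2) ->
  cone H x -> 0 <= x.1 /\ 0 <= x.2.
Proof.
move=> H0; apply: (_ : _ `<=` [set y : R * R | 0 <= y.1 /\ 0 <= y.2]).
apply: smallest_sub; last by move=> _ [p /H0[p1 p2] <-] /=; rewrite !ler0z.
split=> //= [y z [? ?] [? ?]|t y t0 [? ?]].
  by split; rewrite addr_ge0.
by split; rewrite mulr_ge0.
Qed.

Lemma extremal_ray_side C L a a' x : convex_cone C -> extremal_ray C L ->
  L a -> C a' -> C x -> 0 < det2 a a' -> 0 < a.1 -> 0 <= a'.1 -> 0 <= x.1 ->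
  0 <= det2 a x.
Proof.
move=> [C0 CD CZ] [[e e0 ->] LC Lface] [t t0 aE] Ca' Cx aa'_gt0 a1 a'1 x1.
rewrite leNgt; apply/negP => ax_lt0.
have det_ray z : ray e z -> det2 a z = 0.
  by case=> s _ ->; rewrite aE !scale_pairE /det2 /=; ring.
have cramer : det2 x a' *: a = det2 a a' *: x + (- det2 a x) *: a'.
  by apply: injective_projections; rewrite !scale_pairE /det2 /=; ring.
(* First coordinates in [cramer] decide this sign: [a] cannot point opposite to a combination of [x]
   and [a'] in the right half-plane. *)
have xa'_ge0 : 0 <= det2 x a'.
  have E : det2 x a' * a.1 = det2 a a' * x.1 + (- det2 a x) * a'.1.
    by have := congr1 fst cramer; rewrite !scale_pairE.
  rewrite -(pmulr_lge0 _ a1) E.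
  by rewrite addr_ge0 // mulr_ge0 // ?oppr_ge0 ltW.
have [|||+ _] := Lface (det2 a a' *: x) (- det2 a x *: a').
- by apply: CZ; rewrite // ltW.
- by apply: CZ; rewrite // oppr_ge0 ltW.
- rewrite -cramer aE scalerA; exists (det2 x a' * t) => //.
  by rewrite mulr_ge0.
move=> /det_ray.
have -> : det2 a (det2 a a' *: x) = det2 a a' * det2 a x.
  by rewrite scale_pairE /det2 /=; ring.
by move/eqP; rewrite mulf_eq0 (gt_eqF aa'_gt0) (lt_eqF ax_lt0).
Qed.

(** The points [0], [a], [a'] are affinely independent, so the hull is the whole plane and [relint]
    becomes the interior. *)
Lemma affine_hull_cone C a a' x : convex_cone C -> C a -> C a' ->
  det2 a a' != 0 -> affine_hull C x.
Proof.
move=> [C0 CD CZ] Ca Ca' d0 A [Aaff CA].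
have AZ (t : R) z : C z -> A (t *: z).
  by move=> Cz; rewrite -[t *: z]addr0 -(scaler0 _ (1 - t)); apply: Aaff; exact: CA.
(* A midpoint of the two Cramer components of [x], each doubled to offset the weight 1/2. *)
have -> : x = 2^-1 *: ((2 * (det2 x a' / det2 a a')) *: a)
    + (1 - 2^-1) *: ((2 * (det2 a x / det2 a a')) *: a').
  rewrite !scale_pairE.
  by apply: injective_projections; rewrite /det2 /= in d0 *; field.
by apply: Aaff; exact: AZ.
Qed.

(** A small downward move of [b] stays in [C] and lowers [det2 a b] by a positive amount, yet the
    result is still nonnegative. *)
Lemma relint_side_gt0 C a a' b : convex_cone C -> C a -> C a' ->
  0 < det2 a a' -> 0 < a.1 -> (forall x, C x -> 0 <= det2 a x) ->
  relint C b -> 0 < det2 a b.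
Proof.
move=> Ccone Ca Ca' d0 a1 side [Cb nearb].
have {}nearb : \forall y \near b, C y.
  near=> y; have : affine_hull C y -> C y by near: y.
  by apply; apply: (affine_hull_cone _ Ccone Ca Ca'); rewrite gt_eqF.
have cvgb : (b.1, b.2 - t) @[t --> (0 : R)] --> (b.1, b.2 - 0).
  apply: (@cvg_pair _ _ _ _ (nbhs b.1) (nbhs (b.2 - 0))).
    exact: cvg_cst.
  by apply: cvgB; [exact: cvg_cst|exact: cvg_id].
rewrite subr0 -surjective_pairing in cvgb.
have [t t0 Ct] : exists2 t : R, 0 < t & C (b.1, b.2 - t).
  have /nbhs_ballP[e /= e0 eC] : \forall t \near (0 : R), C (b.1, b.2 - t).
    exact: cvgb nearb.
  exists (e / 2); first exact: divr_gt0.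
  by apply: eC; rewrite /ball /= sub0r normrN gtr0_norm ?divr_gt0//; lra.
have := side _ Ct; rewrite /det2 /= => ?.
have := mulr_gt0 a1 t0; lra.
Unshelve. all: by end_near. Qed.

(** A point near [x] lies above the line of [a] and below a point of [C] on the same vertical, hence
    in the cone spanned by [a] and that point. This serves to lower the bottom element. *)
Lemma relint_down C a x : convex_cone C -> C a -> 0 < a.1 ->
  (forall y, C y -> 0 <= y.1) ->
  (\forall y \near (x.1, x.2 + 1), C y) -> 0 < det2 a x -> relint C x.
Proof.
move=> [C0 CD CZ] Ca a1 C_ge0 nearx ax_gt0.
have cvg1 : y.1 @[y --> x] --> x.1 by exact: cvg_fst.
have cvg2 : y.2 @[y --> x] --> x.2 by exact: cvg_snd.
have nearC : \forall y \near x, C (y.1, y.2 + 1).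
  have cvgx : (y.1, y.2 + 1) @[y --> x] --> (x.1, x.2 + 1).
    apply: (@cvg_pair _ _ _ _ (nbhs x.1) (nbhs (x.2 + 1))) => //.
    by apply: cvgD => //; exact: cvg_cst.
  exact: cvgx nearx.
have neardet : \forall y \near x, 0 < det2 a y.
  have : det2 a y @[y --> x] --> det2 a x.
    by apply: cvgB; apply: cvgM => //; exact: cvg_cst.
  by move/cvgr_gt; apply.
have near_in : \forall y \near x, C y.
  near=> y.
  have Cy : C (y.1, y.2 + 1) by near: y.
  have d_gt0 : 0 < det2 a y by near: y.
  have y_ge0 := C_ge0 _ Cy; rewrite /= in y_ge0.
  have den_gt0 : 0 < det2 a y + a.1 by rewrite addr_gt0.
  (* [y] is in cone(a, y + (0, 1)). *)
  have -> : y = (y.1 / (det2 a y + a.1)) *: a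
      + (det2 a y / (det2 a y + a.1)) *: (y.1, y.2 + 1).
    have den_neq0 : a.1 * y.2 - a.2 * y.1 + a.1 != 0 by rewrite gt_eqF.
    rewrite !scale_pairE.
    by apply: injective_projections; rewrite /det2 /=; field.
  by apply: CD; apply: CZ => //; rewrite divr_ge0 // ltW.
by split; [exact: (nbhs_singleton near_in)|apply: filterS near_in].
Unshelve. all: by end_near. Qed.

End ConeGeometry.

Lemma bottom_element_det (R : realType) (H : set (int * int))
    (x1 y1 x2 y2 u v : int) :
  normal_affine_semigroup2 R H -> extremal_vector R H (x1, y1) ->
  extremal_vector R H (x2, y2) -> 0 < x1 ->
  x2 = 0 \/ y1%:~R / x1%:~R < y2%:~R / x2%:~R :> R ->
  bottom_element R H (u, v) -> 0 <= u /\ 0 < det2 (x1, y1) (u, v) <= x1.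
Proof.
move=> [H0 _ _ _] [Ha _ [L Lext La]] [Ha' prim' _] x1_gt0 slope [b_in b_min].
have Ccone := cone_convex R H.
have Ca := @toR2_cone R H _ Ha; have Ca' := @toR2_cone R H _ Ha'.
have C_ge0 (x : R * R) : cone H x -> 0 <= x.1 by case/(cone_ge0 H0).
have a1 : 0 < (toR2 R (x1, y1)).1 by rewrite ltr0z.
have [/= x2_ge0 y2_ge0] := H0 _ Ha'.
have aa' : 0 < det2 (toR2 R (x1, y1)) (toR2 R (x2, y2)).
  rewrite /det2 /=.
  have [x20|x20] := eqVneq x2 0.
    rewrite x20 mulr0 subr0 -intrM ltr0z mulr_gt0 // lt_def y2_ge0 andbT.
    (* Primitivity excludes the zero vector, so [y2] is positive on the vertical ray. *)
    by apply: contraTneq prim' => y20; rewrite /primitive /= x20 y20.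
  have x2_gt0 : 0 < x2 by rewrite lt_def x20.
  case: slope => [/eqP|]; first by rewrite (negPf x20).
  by rewrite ltr_pdivrMr ?ltr0z // mulrAC ltr_pdivlMr ?ltr0z // subr_gt0 mulrC
    [X in _ < X]mulrC [X in X < _]mulrC.
have side x : cone H x -> 0 <= det2 (toR2 R (x1, y1)) x.
  move=> Cx; have xE := C_ge0 _ Cx; have a'E := C_ge0 _ Ca'.
  exact: (extremal_ray_side Ccone Lext La Ca' _ aa').
have bC : cone H (toR2 R (u, v)) by case: b_in.
split; first by have := C_ge0 _ bC; rewrite /= ler0z.
apply/andP; split.
  by rewrite -(@ltr0z R) -det2_toR2; apply: (relint_side_gt0 Ccone Ca Ca').
rewrite leNgt; apply/negP => Dx.
(* Lowering by one costs [x1] in the determinant, which stays positive when it exceeds [x1]. *)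
have : omega R H (u, v - 1).
  apply: (relint_down Ccone Ca a1 C_ge0).
    rewrite /= intrB subrK; case: b_in => _; apply: filterS => y; apply.
    by apply: (affine_hull_cone _ Ccone Ca Ca'); rewrite gt_eqF.
  by rewrite det2_toR2 ltr0z; move: Dx; rewrite /det2 /=; lia.
by move=> /b_min[_] /=; lia.
Qed.

(** Pairing with [a1] isolates [s] as a quotient of determinants. The first coordinate then gives
    [r = (k - s * u) / x1], which lies in (0, 1) because [0 <= s * u <= u < k < x1]. *)
Lemma Hstar_det (R : realType) (x1 y1 u v k w : int) :
  0 <= u -> u < k < x1 -> 0 < det2 (x1, y1) (u, v) ->
  Hstar R (x1, y1) (u, v) (k, w) <->
  0 < det2 (x1, y1) (k, w) < det2 (x1, y1) (u, v).
Proof.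
move=> u_ge0 /andP[uk kx] D_gt0.
have DR_gt0 : 0 < (det2 (x1, y1) (u, v))%:~R :> R by rewrite ltr0z.
rewrite -!(ltr_int R).
split=> [[r [s [_ /andP[s0 s1] E]]]|/andP[w0 wD]].
  have -> : (det2 (x1, y1) (k, w))%:~R = s * (det2 (x1, y1) (u, v))%:~R :> R.
    by rewrite -!det2_toR2 E !scale_pairE /det2 /=; ring.
  by rewrite mulr_gt0 //= gtr_pMl.
move: u_ge0 uk kx; rewrite -(ler_int R) -!(ltr_int R) => u_ge0 uk kx.
have x1_gt0 : 0 < x1%:~R :> R by lra.
set s : R := (det2 (x1, y1) (k, w))%:~R / (det2 (x1, y1) (u, v))%:~R.
have s0 : 0 < s by rewrite divr_gt0.
have s1 : s < 1 by rewrite ltr_pdivrMr ?mul1r.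
have su_ge0 : 0 <= s * u%:~R by rewrite mulr_ge0 // ltW.
have su_le : s * u%:~R <= u%:~R by rewrite ler_piMl // ltW.
exists ((k%:~R - s * u%:~R) / x1%:~R), s; split.
- by rewrite divr_gt0 /= ?ltr_pdivrMr //; lra.
- by rewrite s0.
- have sD : (det2 (x1, y1) (k, w))%:~R = s * (det2 (x1, y1) (u, v))%:~R :> R.
    by rewrite /s divfK // gt_eqF.
  have x1_neq0 : x1%:~R != 0 :> R by rewrite gt_eqF.
  rewrite !scale_pairE; apply: injective_projections => /=.
    by rewrite divfK // subrK.
  apply: (mulfI x1_neq0); move: sD; rewrite -!det2_toR2 /det2 /= => sD.
  rewrite mulrDr [x1%:~R * (_ / _ * _)]mulrA [x1%:~R * (_ / _)]mulrC divfK //.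
  by lra.
Qed.

(** Makes [r i] positive for [0 < i < x1], so that the ceiling of [i * y1 / x1] is [q i + 1] and not
    [q i]. *)
Lemma ndvd_scaled (x1 y1 i : int) :
  coprimez x1 y1 -> 0 < i < x1 -> ~~ (x1 %| i * y1)%Z.
Proof.
move=> co /andP[i0 ix]; rewrite Gauss_dvdzl //.
apply/negP => /dvdzP[m E].
by have [m_le0|m_gt0] := lerP m 0; nia.
Qed.

Theorem lemma5p18 (R : realType) (H : set (int * int))
    (x1 y1 x2 y2 u v : int) (q r : int -> int) (k : int)
    (HN2 : normal_affine_semigroup2 R H)
    (ext1 : extremal_vector R H (x1, y1))
    (ext2 : extremal_vector R H (x2, y2))
    (x1_gt0 : 0 < x1)
    (slope_lt : x2 = 0 \/ y1%:~R / x1%:~R < y2%:~R / x2%:~R :> R)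
    (bottom : bottom_element R H (u, v))
    (H1_neq0 : Hstar R (x1, y1) (u, v) !=set0)
    (qr : forall i : int, i * y1 = q i * x1 + r i /\ 0 <= r i < x1)
    (k_bounds : u < k < x1) :
  [<-> (* i    *) exists2 p, Hstar R (x1, y1) (u, v) p & p.1 = k;
       (* ii   *) Num.ceil (k%:~R * y1%:~R / x1%:~R : R)
                    <= v + Num.floor ((k - u)%:~R * y1%:~R / x1%:~R : R);
       (* iii  *) Num.ceil (k%:~R * y1%:~R / x1%:~R : R)
                    = v + Num.floor ((k - u)%:~R * y1%:~R / x1%:~R : R);
       (* iv   *) q k <= v - 1 + q (k - u);
       (* v    *) q k = v - 1 + q (k - u);
       (* vi   *) r k >= r (k - u) + x1 - (v * x1 - u * y1);
       (* vii  *) r k = r (k - u) + x1 - (v * x1 - u * y1);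
       (* viii *) r k >= x1 - (v * x1 - u * y1)]
  /\ (forall p, Hstar R (x1, y1) (u, v) p -> p.1 = k ->
        p = (k, Num.ceil (k%:~R * y1%:~R / x1%:~R : R))
        /\ p = (k, q k + 1)).
Proof.
have [u_ge0 /andP[D_gt0 D_le]] :=
  bottom_element_det HN2 ext1 ext2 x1_gt0 slope_lt bottom.
have co : coprimez x1 y1 by case: ext1.
have /andP[uk kx] := k_bounds.
have x1R_gt0 : 0 < x1%:~R :> R by rewrite ltr0z.
have r_gt0 (i : int) : 0 < i < x1 -> 0 < r i.
  move=> /(ndvd_scaled co); have [E /andP[ri _]] := qr i.
  rewrite lt_def ri andbT; apply: contra => /eqP r0.
  by rewrite E r0 addr0 dvdz_mull.
have rk_gt0 : 0 < r k by apply: r_gt0; lia.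
have rku_gt0 : 0 < r (k - u) by apply: r_gt0; lia.
have [Ek /andP[_ rk_lt]] := qr k.
have [Eku /andP[_ rku_lt]] := qr (k - u).
have -> : Num.ceil (k%:~R * y1%:~R / x1%:~R : R) = q k + 1.
  apply: ceil_def; rewrite addrK -intrM Ek ltr_pdivlMr // ler_pdivrMr //.
  by rewrite -!intrM ltr_int ler_int; apply/andP; split; lia.
have -> : Num.floor ((k - u)%:~R * y1%:~R / x1%:~R : R) = q (k - u).
  apply: floor_def; rewrite -intrM Eku ler_pdivlMr // ltr_pdivrMr //.
  by rewrite -!intrM ltr_int ler_int; apply/andP; split; lia.
have HstarE w := Hstar_det R w u_ge0 k_bounds D_gt0.
rewrite /det2 /= in D_gt0 D_le HstarE.
set m := v - 1 + q (k - u) - q k.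
have mE : x1 * m = r k - r (k - u) + (v * x1 - u * y1) - x1.
  by rewrite /m; lia.
(* The remainders differ by less than [x1] and the determinant is at most [x1], so [x1 * m < x1]. *)
have m_le0 : m <= 0 by nia.
have m_eq0 : 0 <= m -> r k = r (k - u) + x1 - (v * x1 - u * y1).
  by move=> m0; have m00 : m = 0 by [lia]; move: mE; rewrite m00 mulr0; lia.
(* The point lies strictly between the line of [a1] and its parallel through [b]; rounding to
   integers bounds [w] on both sides. *)
have Hstar_wE w : Hstar R (x1, y1) (u, v) (k, w) -> 0 <= m /\ w = q k + 1.
  move=> /HstarE /andP[w0 wD].
  have w_ge : q k + 1 <= w by nia.
  have w_le : w <= v + q (k - u) by nia.
  by split; lia.
split; last first.
  by move=> [k' w] Hp /= ?; subst k'; have [_ ->] := Hstar_wE _ Hp.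
tfae; rewrite /m in m_le0 m_eq0 Hstar_wE mE *.
- by case=> -[k' w] Hp /= ?; subst k'; have [? _] := Hstar_wE _ Hp; lia.
- lia.
- lia.
- lia.
- by move=> ?; have := m_eq0; lia.
- by move=> ?; apply: m_eq0; nia.
- lia.
(* By (viii), [x1 * m >= - r (k - u) > - x1], so [m = 0]. The determinant [x1 - r k] of this point
   is then that of [b] minus [r (k - u)], and [r (k - u) > 0] makes the upper bound strict. *)
- move=> ?; exists (k, q k + 1) => //; apply/HstarE.
  by have := m_eq0; nia.
Qed.
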